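(* Let $r_3=0$ and $0<r_1\le r_2$, and let $P_1,P_2,P_3$ be independent random points with $P_k$ uniform on the circle of radius $r_k$ about $O$ (so $P_3=O$). Then $$P(\text{obtuse})=1-\frac1\pi\arcsin\!\left(\frac{r_1}{r_2}\right).$$
   Context: $O$ is the origin of $\mathbb{R}^2$. $P(\text{obtuse})$ is the probability that $P_1,P_2,P_3$ form a (non-degenerate) triangle that is obtuse, i.e. has some interior angle exceeding $\pi/2$. Throughout the paper at most one of the three radii is allowed to be zero. *)

(* Defs.v *)
From HB Require Import structures.
From mathcomp Require Import all_boot all_order all_algebra.
From mathcomp Require Import all_classical all_reals all_analysis.
Import Order.TTheory GRing.Theory Num.Theory.
Import numFieldNormedType.Exports.

Set Implicit Arguments.
Unset Strict Implicit.
Unset Printing Implicit Defensive.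

Local Open Scope classical_set_scope.
Local Open Scope ring_scope.

(* The norm that the library puts on a product type is the sup norm, hence the
   explicit Euclidean inner product and norm below. *)
Notation plane R := (measurableTypeR R * measurableTypeR R)%type.

Section plane_geometry.
Variable R : realType.
Implicit Types A B C u v : plane R.

Definition dot u v : R := u.1 * v.1 + u.2 * v.2.

Definition enorm u : R := Num.sqrt (dot u u).

Definition vec A B : plane R := (B.1 - A.1, B.2 - A.2).

(* The interior angle at the middle vertex [B]. *)
Definition angle A B C : R :=
  acos (dot (vec B A) (vec B C) / (enorm (vec B A) * enorm (vec B C))).

Definition collinear A B C : Prop :=
  exists a b c : R, (a, b) <> (0, 0) /\
    forall D, [\/ D = A, D = B | D = C] -> a * D.1 + b * D.2 = c.

Definition obtuse_triangle A B C : Prop :=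
  ~ collinear A B C /\
  [\/ pi / 2 < angle C A B, pi / 2 < angle A B C | pi / 2 < angle B C A].

Definition circle_point (r theta : R) : plane R :=
  (r * cos theta, r * sin theta).

Lemma two_pi_gt0 : 0 < 2 * pi :> R.
Proof. by rewrite mulr_gt0// pi_gt0. Qed.

(* Uniform law on the circle of radius [r] about the origin: the law of the
   point at a uniform polar angle; for [r = 0] it is the Dirac mass at the
   origin. *)
Definition uniform_circle (r : R) : set (plane R) -> \bar R :=
  pushforward (uniform_prob two_pi_gt0) (circle_point r).

End plane_geometry.

Section random_points.
Context (d d' : measure_display) (T : measurableType d)
  (U : measurableType d') (R : realType) (P : probability T R).

Definition mutually_independent (I : finType) (X : I -> {RV P >-> U}) : Prop :=
  forall (J : {set I}) (A : I -> set U), (forall i, measurable (A i)) ->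
    P (\bigcap_(i in [set` J]) (X i @^-1` A i)) =
    (\prod_(i in J) P (X i @^-1` A i))%E.

End random_points.

Definition uniform_on_circle (d : measure_display) (T : measurableType d)
    (R : realType) (P : probability T R) (r : R) (X : {RV P >-> plane R}) :=
  forall A : set (plane R), measurable A ->
    distribution P X A = uniform_circle r A.

(* Main.v *)
Require Import Defs.
From HB Require Import structures.
From mathcomp Require Import all_boot all_order all_algebra.
From mathcomp Require Import all_classical all_reals all_analysis.
From mathcomp Require Import measurable_realfun.
From mathcomp Require Import ring lra.
Import Order.TTheory GRing.Theory Num.Theory.
Import numFieldNormedType.Exports.

Local Open Scope classical_set_scope.
Local Open Scope ring_scope.

(** With [P1] and [P2] at polar angles [a] and [b] and [P3] at the origin, the
three dot products that decide the signs of the cosines of the interior angles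
depend only on [x = b - a]: the angle at the origin is obtuse when [cos x < 0],
the angle at [P1] when [cos x > r1 / r2], and the angle at [P2] never, because
[r1 <= r2]. The triangle is non-degenerate when [sin x != 0]
([obtuse_triangle_circle]).

For a fixed [a] the law of [b - a] modulo a full turn is again uniform, by
translation invariance of Lebesgue measure ([uniform_prob_rotation]). So the
conditional probability given [P1] is the constant proportion of a full turn
occupied by the set of obtuse differences. Up to finitely many points that set
is given by [x < acos (r1 / r2)], [pi / 2 < x < 3 * pi / 2] or
[2 * pi - acos (r1 / r2) < x], of total length [2 * acos (r1 / r2) + pi]
([uniform_prob_obtuse_angles]). Independence turns the probability into an
iterated integral ([probability_pair]). Finally, [P3] is only almost surely
equal to the origin; the event that it is has probability one and can be
intersected with freely ([probability_setI1]). *)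

(** * Obtuse triangles and dot products *)

(** Signed area of the parallelogram spanned by [u] and [v]. *)
Definition cross {R : realType} (u v : plane R) : R := u.1 * v.2 - u.2 * v.1.

Lemma collinearE (R : realType) (A B C : plane R) :
  collinear A B C <-> cross (vec A B) (vec A C) = 0.
Proof.
case: A B C => [A1 A2] [B1 B2] [C1 C2]; rewrite /cross /vec/=; split.
  move=> [a [b [c [ab0 abc]]]].
  have /= eA := abc (A1, A2) (Or31 _ _ erefl).
  have /= eB := abc (B1, B2) (Or32 _ _ erefl).
  have /= eC := abc (C1, C2) (Or33 _ _ erefl).
  set D := (_ - _ * _).
  have eAB : a * (B1 - A1) = - (b * (B2 - A2)) by lra.
  have eAC : a * (C1 - A1) = - (b * (C2 - A2)) by lra.
  have aD : a * D = 0.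
    transitivity (a * (B1 - A1) * (C2 - A2) - (B2 - A2) * (a * (C1 - A1))).
      by rewrite /D; ring.
    by rewrite eAB eAC; ring.
  have bD : b * D = 0.
    transitivity ((C1 - A1) * - (- (b * (B2 - A2))) * -1 +
        (B1 - A1) * - (- (b * (C2 - A2)))); first by rewrite /D; ring.
    by rewrite -eAB -eAC; ring.
  have [//|D0] := eqVneq D 0.
  move/eqP: aD; rewrite mulf_eq0 (negbTE D0) orbF => /eqP a0.
  move/eqP: bD; rewrite mulf_eq0 (negbTE D0) orbF => /eqP b0.
  by exfalso; apply: ab0; rewrite a0 b0.
move=> D0.
(* A normal vector of the line is obtained from [vec A B] if [B <> A], else from
   [vec A C] if [C <> A]; when all three points coincide any vector will do. *)
have [[B1E B2E]|nB] := pselect (B1 = A1 /\ B2 = A2); last first.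
  exists (A2 - B2), (B1 - A1), ((A2 - B2) * A1 + (B1 - A1) * A2); split.
    by move=> [] /eqP h1 /eqP h2; apply: nB; split; lra.
  by move=> D [] -> /=; lra.
have [[C1E C2E]|nC] := pselect (C1 = A1 /\ C2 = A2); last first.
  exists (A2 - C2), (C1 - A1), ((A2 - C2) * A1 + (C1 - A1) * A2); split.
    by move=> [] h1 h2; apply: nC; split; lra.
  by move=> D [] -> /=; rewrite ?B1E ?B2E; lra.
exists 1, 0, A1; split; first by move=> [] /eqP; rewrite oner_eq0.
by move=> D [] -> /=; rewrite ?B1E ?C1E; lra.
Qed.

Lemma acos_gt_pihalf (R : realType) (x : R) : -1 <= x <= 1 ->
  (pi / 2 < acos x) = (x < 0).
Proof.
move=> x1; have xI : x \in `[-1, 1] by rewrite in_itv.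
rewrite -ltr_cos ?cos_pihalf ?acosK// in_itv/= ?acos_ge0 ?acos_lepi//.
by have := @pi_gt0 R; lra.
Qed.

Lemma dot_ge0 (R : realType) (u : plane R) : 0 <= dot u u.
Proof. by rewrite /dot -!expr2 addr_ge0 ?sqr_ge0. Qed.

Lemma dot_gt0 (R : realType) (u : plane R) : u != (0, 0) -> 0 < dot u u.
Proof.
case: u => a b u0; rewrite lt_neqAle dot_ge0 andbT eq_sym /dot/= -!expr2.
rewrite paddr_eq0 ?sqr_ge0// !sqrf_eq0; apply: contra u0.
by move=> /andP[/eqP-> /eqP->].
Qed.

Lemma CauchySchwarz_dot (R : realType) (u v : plane R) :
  `|dot u v| <= enorm u * enorm v.
Proof.
rewrite -sqrtr_sqr -sqrtrM ?dot_ge0// ler_sqrt ?mulr_ge0 ?dot_ge0//.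
rewrite -subr_ge0 [leRHS](_ : _ = cross u v ^+ 2) ?sqr_ge0//.
by rewrite /dot /cross; ring.
Qed.

Lemma angle_gt_pihalf (R : realType) (A B C : plane R) : A <> B -> C <> B ->
  (pi / 2 < angle A B C) = (dot (vec B A) (vec B C) < 0).
Proof.
have vec_neq0 D : D <> B -> 0 < enorm (vec B D).
  case: B D => [B1 B2] [D1 D2] DB; rewrite sqrtr_gt0 dot_gt0//.
  by apply/eqP => -[h1 h2]; apply: DB; congr (_, _); lra.
move=> /vec_neq0 A0 /vec_neq0 C0; rewrite /angle.
have N0 := mulr_gt0 A0 C0.
rewrite acos_gt_pihalf; first by rewrite pmulr_llt0 ?invr_gt0.
rewrite -ler_norml normrM normfV [X in _ / X]gtr0_norm//.
by rewrite ler_pdivrMr// mul1r CauchySchwarz_dot.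
Qed.

(** The trigonometric definition of an obtuse triangle in polynomial terms: an
angle exceeds [pi / 2] when the dot product of its two sides is negative. *)
Lemma obtuse_triangleE (R : realType) (A B C : plane R) :
  obtuse_triangle A B C <->
  cross (vec A B) (vec A C) <> 0 /\
  [\/ dot (vec A C) (vec A B) < 0, dot (vec B A) (vec B C) < 0 |
      dot (vec C B) (vec C A) < 0].
Proof.
rewrite /obtuse_triangle collinearE.
have [c0|c0] := pselect (cross (vec A B) (vec A C) = 0).
  by split => -[].
have nAB : A <> B by move=> e; apply: c0; rewrite e /cross /vec/=; ring.
have nAC : A <> C by move=> e; apply: c0; rewrite e /cross /vec/=; ring.
have nBC : B <> C by move=> e; apply: c0; rewrite e /cross /vec/=; ring.
by rewrite !angle_gt_pihalf//; exact: nesym.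
Qed.

Lemma obtuse_triangle_circle (R : realType) (r1 r2 a b : R) :
  0 < r1 -> r1 <= r2 ->
  obtuse_triangle (circle_point r1 a) (circle_point r2 b) (0, 0) <->
  sin (b - a) != 0 /\ (cos (b - a) < 0 \/ r1 / r2 < cos (b - a)).
Proof.
move=> r1_gt0 r12; have r2_gt0 := lt_le_trans r1_gt0 r12.
have r1r2_gt0 := mulr_gt0 r1_gt0 r2_gt0.
rewrite obtuse_triangleE /circle_point.
have -> : cross (vec (r1 * cos a, r1 * sin a) (r2 * cos b, r2 * sin b))
    (vec (r1 * cos a, r1 * sin a) (0, 0)) = (r1 * r2) * sin (b - a).
  by rewrite sinB /cross /vec/=; ring.
have norm_circle (r t : R) : (r * cos t) ^+ 2 + (r * sin t) ^+ 2 = r ^+ 2.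
  by rewrite !exprMn -mulrDr cos2Dsin2 mulr1.
have -> : dot (vec (r1 * cos a, r1 * sin a) (0, 0))
    (vec (r1 * cos a, r1 * sin a) (r2 * cos b, r2 * sin b)) =
    r1 * (r1 - r2 * cos (b - a)).
  transitivity (r1 ^+ 2 - r1 * r2 * cos (b - a)); last by ring.
  by rewrite -(norm_circle r1 a) cosB /dot /vec/=; ring.
have -> : dot (vec (r2 * cos b, r2 * sin b) (r1 * cos a, r1 * sin a))
    (vec (r2 * cos b, r2 * sin b) (0, 0)) =
    r2 * (r2 - r1 * cos (b - a)).
  transitivity (r2 ^+ 2 - r1 * r2 * cos (b - a)); last by ring.
  by rewrite -(norm_circle r2 b) cosB /dot /vec/=; ring.
have -> : dot (vec (0, 0) (r2 * cos b, r2 * sin b))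
    (vec (0, 0) (r1 * cos a, r1 * sin a)) = (r1 * r2) * cos (b - a).
  by rewrite cosB /dot /vec/=; ring.
rewrite !pmulr_rlt0// !subr_lt0 ltr_pdivrMr// [cos _ * r2]mulrC.
(* The angle at the second vertex is never obtuse. *)
have r2c : (r2 < r1 * cos (b - a)) = false.
  by apply/negP/negP; rewrite -leNgt; have := cos_le1 (b - a); nra.
rewrite r2c; split.
  move=> [s0 [h|//|h]]; (split; [by apply/eqP => s; apply: s0; rewrite s mulr0|]).
    by right.
  by left.
move=> [/eqP s0 hc]; split.
  by move/eqP; rewrite mulf_eq0 (gt_eqF r1r2_gt0)/= => /eqP.
by case: hc; [exact: Or33|exact: Or31].
Qed.

(** * Rotation invariance of the uniform law on angles *)

Lemma measurable_subr (R : realType) (c : R) :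
  measurable_fun [set: measurableTypeR R]
    (fun x => x - c : measurableTypeR R).
Proof. exact: measurable_funB. Qed.

Lemma lebesgue_measure_subr (R : realType) (c : R) (A : set R) :
  measurable A ->
  lebesgue_measure ((fun x : measurableTypeR R => x - c) @^-1` A) =
  lebesgue_measure A.
Proof.
move=> mA.
pose h : {mfun measurableTypeR R >-> measurableTypeR R} :=
  HB.pack (fun x : measurableTypeR R => x - c : measurableTypeR R)
    (isMeasurableFun.Build _ _ _ _ _ (@measurable_subr R c)).
apply/esym; change (lebesgue_measure A = pushforward lebesgue_measure h A).
apply: lebesgue_measure_unique => //= _ [[a b]] _ <-.
rewrite /pushforward.
have -> : h @^-1` `]a, b]%classic = `]a + c, b + c]%classic.
  by apply/seteqP; split => x /=; rewrite !in_itv/= lerBlDr ltrBrDr.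
rewrite !lebesgue_measure_itv/= !lte_fin ltrD2r.
by rewrite -!EFinB (_ : b + c - (a + c) = b - a)//; ring.
Qed.

(** The half-open interval is a fundamental domain for the rotations; its missing
endpoint is negligible. *)
Lemma uniform_prob_itvco (R : realType) (A : set R) : measurable A ->
  uniform_prob (@two_pi_gt0 R) A =
  ((2 * pi)^-1%:E * lebesgue_measure (A `&` `[0%R, (2 * pi)%R[))%E.
Proof.
move=> mA; rewrite -[X in uniform_prob _ X]setIT -integral_indic//.
rewrite integral_uniform//; last first.
  exact/measurable_EFinP/measurable_indic.
rewrite subr0 -integral_itv_bndo_bndc ?integral_indic//.
exact/measurable_funTS/measurable_EFinP/measurable_indic.
Qed.

Lemma lebesgue_measure_itvco_split (R : realType) (A : set R) (a b c : R) :
  measurable A -> a <= b -> b <= c ->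
  lebesgue_measure (A `&` `[a, c[) =
  (lebesgue_measure (A `&` `[a, b[) + lebesgue_measure (A `&` `[b, c[))%E.
Proof.
move=> mA ab bc.
rewrite (@itv_bndbnd_setU _ _ (BLeft a) (BLeft b) (BLeft c)) ?bnd_simp//.
rewrite setIUr measureU//=; [exact: measurableI|exact: measurableI|].
rewrite setIACA setIid; apply/seteqP; split => x //= [_ []].
by rewrite !in_itv/=; lra.
Qed.

(** Rotation invariance of the uniform law, tested on [2 * pi]-periodic sets. *)
Lemma uniform_prob_rotation (R : realType) (A : set R) (a : R) :
  measurable A -> (forall x, A (x + 2 * pi) <-> A x) -> 0 <= a <= 2 * pi ->
  uniform_prob (@two_pi_gt0 R) ((fun x => x - a) @^-1` A) =
  uniform_prob (@two_pi_gt0 R) A.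
Proof.
move=> mA pA /andP[a0 a2].
have mS : measurable ((fun x : measurableTypeR R => x - a) @^-1` A).
  by rewrite -[X in measurable X]setTI; exact: measurable_subr.
rewrite !uniform_prob_itvco//; congr *%E.
(* Translating by [- a] exchanges two pieces of the circle: [a, 2 * pi[ moves
   onto [0, 2 * pi - a[, and [0, a[ moves, after a full turn, onto
   [2 * pi - a, 2 * pi[. *)
rewrite (@lebesgue_measure_itvco_split _ _ 0 a)//.
rewrite (@lebesgue_measure_itvco_split _ A 0 (2 * pi - a))//; last by lra.
  2: by lra.
rewrite addeC; congr +%E.
  rewrite -(@lebesgue_measure_subr _ a (A `&` `[0, 2 * pi - a[));
    last exact: measurableI.
  congr lebesgue_measure; apply/seteqP; split => x/=; rewrite !in_itv/=;
    by move=> [? ?]; split => //; lra.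
rewrite -(@lebesgue_measure_subr _ (a - 2 * pi)
  (A `&` `[2 * pi - a, 2 * pi[)); last exact: measurableI.
have e x : x - (a - 2 * pi) = x - a + 2 * pi by ring.
congr lebesgue_measure; apply/seteqP; split => x/=; rewrite !in_itv/= e pA;
  by move=> [? ?]; split => //; lra.
Qed.

(** * The set of obtuse differences of angles *)

(** The polar angle differences for which the triangle is obtuse, where [c] is
the ratio of the two radii. *)
Definition obtuse_angles {R : realType} (c : R) : set R :=
  [set x | sin x != 0 /\ (cos x < 0 \/ c < cos x)].

Lemma measurable_obtuse_angles (R : realType) (c : R) :
  measurable (obtuse_angles c).
Proof.
have ms : measurable_fun [set: R] (@sin R).
  by apply: continuous_measurable_fun; exact: continuous_sin.
have mc : measurable_fun [set: R] (@cos R).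
  by apply: continuous_measurable_fun; exact: continuous_cos.
rewrite (_ : obtuse_angles c = ~` (sin @^-1` [set 0]) `&`
    (cos @^-1` `]-oo, 0[ `|` cos @^-1` `]c, +oo[)); last first.
  apply/seteqP; split => x /=; rewrite !in_itv/= andbT.
    by move=> [/eqP].
  by move=> [/eqP].
apply: measurableI; [apply: measurableC|apply: measurableU];
  rewrite -[X in measurable X]setTI.
- exact: ms.
- exact: mc.
- exact: mc.
Qed.

Lemma obtuse_anglesD2pi (R : realType) (c x : R) :
  obtuse_angles c (x + 2 * pi) <-> obtuse_angles c x.
Proof. by rewrite /obtuse_angles/= mulrC mulr_natr sinD2pi cosD2pi. Qed.

Lemma obtuse_anglesN (R : realType) (c x : R) :
  obtuse_angles c (- x) <-> obtuse_angles c x.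
Proof. by rewrite /obtuse_angles/= sinN cosN oppr_eq0. Qed.

Lemma obtuse_angles_0pi (R : realType) (c x : R) : 0 < c <= 1 -> 0 <= x <= pi ->
  obtuse_angles c x <-> 0 < x < acos c \/ pi / 2 < x < pi.
Proof.
move=> /andP[c0 c1] x0pi; have pi0 := @pi_gt0 R.
have cI : c \in `[-1, 1] by rewrite in_itv/=; lra.
have cB : -1 <= c <= 1 by lra.
have xI : x \in `[0, pi] by rewrite in_itv.
have ac0 := acos_ge0 cB; have acpi := acos_lepi cB.
have Epi2 : (cos x < 0) = (pi / 2 < x).
  by rewrite -[X in _ < X]cos_pihalf ltr_cos// in_itv/=; lra.
have Ec : (c < cos x) = (x < acos c).
  by rewrite -[X in X < _](acosK cI) ltr_cos// in_itv/=; lra.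
have ac2 : acos c < pi / 2.
  by rewrite -ltr_cos ?acosK ?cos_pihalf// in_itv/=; lra.
rewrite /obtuse_angles/= Epi2 Ec; split.
  move=> [s0 h].
  have x_neq0 : x != 0 by apply: contra s0 => /eqP->; rewrite sin0.
  have x_neqpi : x != pi by apply: contra s0 => /eqP->; rewrite sinpi.
  move: x0pi; rewrite !le_eqVlt (negbTE x_neqpi) eq_sym (negbTE x_neq0)/=.
  by move=> ?; case: h => h; [right|left]; lra.
move=> h; split; last by lra.
by rewrite gt_eqF// sin_gt0_pi//; lra.
Qed.

Lemma obtuse_angles_itv (R : realType) (c : R) : 0 < c <= 1 ->
  obtuse_angles c `&` `[0, 2 * pi[ =
  `]0, acos c[ `|` `]pi / 2, pi[ `|` `]pi, 3 * (pi / 2)[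
  `|` `](2 * pi - acos c), 2 * pi[%classic.
Proof.
move=> c01; have pi0 := @pi_gt0 R.
have cB : -1 <= c <= 1 by lra.
have ac0 := acos_ge0 cB; have acpi := acos_lepi cB.
(* Reflection in the horizontal axis reduces ]pi, 2 * pi[ to ]0, pi[. *)
have refl x : obtuse_angles c x <-> obtuse_angles c (2 * pi - x).
  by rewrite addrC obtuse_anglesD2pi obtuse_anglesN.
apply/seteqP; split => x /=; rewrite !in_itv/=.
  move=> [Gx x02]; have [xpi|pix] := leP x pi.
    by move: Gx; rewrite obtuse_angles_0pi//; lra.
  by move: Gx; rewrite refl obtuse_angles_0pi//; lra.
have [xpi|pix] := leP x pi => h; (split; last by lra).
  by rewrite obtuse_angles_0pi//; lra.
by rewrite refl obtuse_angles_0pi//; lra.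
Qed.

Lemma acos_asin (R : realType) (x : R) : -1 <= x <= 1 ->
  acos x = pi / 2 - asin x.
Proof.
move=> x1; have l := asin_geNpi2 x1; have u := asin_lepi2 x1.
have xI : x \in `[-1, 1] by rewrite in_itv.
apply: cos_inj; rewrite ?in_itv/= ?acos_ge0 ?acos_lepi//; first by lra.
by rewrite acosK// -opprB cosN cosBpihalf asinK.
Qed.

Lemma uniform_prob_obtuse_angles (R : realType) (c : R) : 0 < c <= 1 ->
  uniform_prob (@two_pi_gt0 R) (obtuse_angles c) = (1 - 1 / pi * asin c)%:E.
Proof.
move=> c01; have pi0 := @pi_gt0 R.
have cB : -1 <= c <= 1 by lra.
have ac0 := acos_ge0 cB; have acpi := acos_lepi cB.
rewrite uniform_prob_itvco; last exact: measurable_obtuse_angles.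
rewrite obtuse_angles_itv// acos_asin//.
have asin_ge0 : 0 <= asin c.
  by rewrite leNgt -ltr_sin ?sin0 ?asinK ?in_itv/= ?asin_geNpi2 ?asin_lepi2//;
    lra.
have asin_le := asin_lepi2 cB.
rewrite measureU//=; last 2 first.
- by repeat apply: measurableU.
- apply/seteqP; split => x //=; rewrite !in_itv/=; lra.
rewrite measureU//=; last 2 first.
- by repeat apply: measurableU.
- apply/seteqP; split => x //=; rewrite !in_itv/=; lra.
rewrite measureU//=; last first.
- apply/seteqP; split => x //=; rewrite !in_itv/=; lra.
have itvE (a b : R) : a <= b -> lebesgue_measure `]a, b[%classic = (b - a)%:E.
  move=> ab; rewrite lebesgue_measure_itv/= lte_fin EFinB.
  by case: ltgtP ab => // -> _; rewrite subee.
do 4 (rewrite itvE; last by lra).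
rewrite -!EFinD -EFinM; congr EFin.
have : pi != 0 :> R by rewrite gt_eqF.
(* [pi] must be opaque to [field], which would unfold it. *)
by generalize (@pi R) => p p0; field.
Qed.

(** * Measurability *)

Lemma measurable_circle_point (R : realType) (r : R) :
  measurable_fun [set: measurableTypeR R] (circle_point r : _ -> plane R).
Proof.
apply: measurable_fun_pair => /=; apply: measurable_funM => //;
  apply: continuous_measurable_fun.
- exact: continuous_cos.
- exact: continuous_sin.
Qed.

Section measurable_obtuse.
Context d (T : measurableType d) (R : realType).
Implicit Types X Y Z : T -> plane R.

Lemma measurable_coord1 X : measurable_fun setT X ->
  measurable_fun setT (fun t => (X t).1 : R).
Proof. by move=> mX; exact: measurableT_comp measurable_fst mX. Qed.

Lemma measurable_coord2 X : measurable_fun setT X ->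
  measurable_fun setT (fun t => (X t).2 : R).
Proof. by move=> mX; exact: measurableT_comp measurable_snd mX. Qed.

Lemma measurable_vec X Y : measurable_fun setT X -> measurable_fun setT Y ->
  measurable_fun setT (fun t => vec (X t) (Y t)).
Proof.
move=> mX mY; apply: measurable_fun_pair => /=; apply: measurable_funB;
  do ?[exact: measurable_coord1|exact: measurable_coord2].
Qed.

Lemma measurable_dot X Y : measurable_fun setT X -> measurable_fun setT Y ->
  measurable_fun setT (fun t => dot (X t) (Y t)).
Proof.
move=> mX mY; apply: measurable_funD; apply: measurable_funM;
  do ?[exact: measurable_coord1|exact: measurable_coord2].
Qed.

Lemma measurable_cross X Y : measurable_fun setT X -> measurable_fun setT Y ->
  measurable_fun setT (fun t => cross (X t) (Y t)).
Proof.
move=> mX mY; apply: measurable_funB; apply: measurable_funM;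
  do ?[exact: measurable_coord1|exact: measurable_coord2].
Qed.

Lemma measurable_obtuse_triangle X Y Z :
  measurable_fun setT X -> measurable_fun setT Y -> measurable_fun setT Z ->
  measurable [set t | obtuse_triangle (X t) (Y t) (Z t)].
Proof.
move=> mX mY mZ.
have dot_lt0 (U V W : T -> plane R) :
    measurable_fun setT U -> measurable_fun setT V -> measurable_fun setT W ->
    measurable [set t | dot (vec (U t) (V t)) (vec (U t) (W t)) < 0].
  move=> mU mV mW.
  have := measurable_dot _ _ (measurable_vec _ _ mU mV)
    (measurable_vec _ _ mU mW).
  move=> /(_ measurableT `]-oo, 0[%classic); rewrite setTI preimage_itvNyo.
  by apply; exact: measurable_itv.
rewrite (_ : [set t | _] =
    ~` [set t | cross (vec (X t) (Y t)) (vec (X t) (Z t)) = 0] `&`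
    ([set t | dot (vec (X t) (Z t)) (vec (X t) (Y t)) < 0] `|`
     [set t | dot (vec (Y t) (X t)) (vec (Y t) (Z t)) < 0] `|`
     [set t | dot (vec (Z t) (Y t)) (vec (Z t) (X t)) < 0])); last first.
  by apply/seteqP; split=> t /=; rewrite obtuse_triangleE => -[? h]; split=> //;
    [case: h; tauto|case: h => [[?|?]|?]; [exact: Or31|exact: Or32|exact: Or33]].
apply: measurableI; last by do 2?apply: measurableU; exact: dot_lt0.
apply: measurableC; have := measurable_cross _ _ (measurable_vec _ _ mX mY)
  (measurable_vec _ _ mX mZ).
by move=> /(_ measurableT [set 0]); rewrite setTI; apply.
Qed.

End measurable_obtuse.

(** * Independence *)

(** The joint law of two independent random variables is the product of their
laws, so that the probability of [S] can be computed by fixing [X] first. *)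
Lemma probability_pair (d d1 d2 : measure_display) (T : measurableType d)
    (T1 : measurableType d1) (T2 : measurableType d2) (R : realType)
    (P : probability T R) (X : {RV P >-> T1}) (Y : {RV P >-> T2})
    (S : set (T1 * T2)) :
  (forall A B, measurable A -> measurable B ->
    P (X @^-1` A `&` Y @^-1` B) = (P (X @^-1` A) * P (Y @^-1` B))%E) ->
  measurable S ->
  P [set t | S (X t, Y t)] =
  (\int[distribution P X]_x distribution P Y (xsection S x))%E.
Proof.
move=> XY mS.
have mXY : measurable_fun setT (fun t => (X t, Y t)).
  exact: measurable_fun_pair.
pose Z : {RV P >-> (T1 * T2)%type} :=
  HB.pack (fun t => (X t, Y t)) (isMeasurableFun.Build _ _ _ _ _ mXY).
have := @product_measure_unique _ _ _ _ _ (distribution P X) (distribution P Y)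
  (distribution P Z).
by move=> joint; rewrite -[LHS]/(distribution P Z S) -joint.
Qed.

Lemma probability_setI1 (d : measure_display) (T : measurableType d)
    (R : realType) (P : probability T R) (E F : set T) :
  measurable E -> measurable F -> P F = 1%E -> P (E `&` F) = P E.
Proof.
move=> mE mF PF.
have PFC : P (~` F) = 0%E by rewrite probability_setC// PF subee.
rewrite -[in RHS](setIT E) -(setUv F) setIUr [RHS]measureU0//.
- exact: measurableI.
- by apply: measurableI => //; exact: measurableC.
- apply: (@subset_measure0 _ _ _ P _ (~` F)) => //.
  by apply: measurableI => //; exact: measurableC.
  exact: measurableC.
Qed.

Lemma mutually_independent_pair (d d' : measure_display) (T : measurableType d)
    (U : measurableType d') (R : realType) (P : probability T R)
    (X Y Z : {RV P >-> U}) (A B : set U) :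
  mutually_independent (tnth [tuple X; Y; Z]) -> measurable A -> measurable B ->
  P (X @^-1` A `&` Y @^-1` B) = (P (X @^-1` A) * P (Y @^-1` B))%E.
Proof.
move=> indep mA mB.
(* The third factor is the whole space, the default value of [nth]. *)
pose C (i : 'I_3) := nth setT [:: A; B] i.
have mC i : measurable (C i) by rewrite /C; case: i => [[|[|[|]]]]//=.
have := indep [set: 'I_3]%SET C mC.
rewrite (eq_bigl xpredT) ?big_ord_recl/=; last by move=> i; rewrite inE.
rewrite big_ord0 mule1.
have -> : \bigcap_(i in [set` [set: 'I_3]%SET])
    (tnth [tuple X; Y; Z] i @^-1` C i) = X @^-1` A `&` Y @^-1` B.
  apply/seteqP; split => t /=.
    move=> h; split.
      by have := h ord0; apply; rewrite /= inE.
    by have := h (lift ord0 ord0); apply; rewrite /= inE.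
  by move=> [At Bt] [[|[|[|]]]].
by move=> ->; rewrite preimage_setT probability_setT mule1.
Qed.

(** * The probability of an obtuse triangle *)

(** The case of a third vertex that is the origin everywhere, not just almost
surely. *)
Lemma probability_obtuse_circles (d : measure_display) (T : measurableType d)
    (R : realType) (P : probability T R) (r1 r2 : R)
    (X Y : {RV P >-> plane R}) :
  0 < r1 -> r1 <= r2 -> uniform_on_circle r1 X -> uniform_on_circle r2 Y ->
  (forall A B, measurable A -> measurable B ->
    P (X @^-1` A `&` Y @^-1` B) = (P (X @^-1` A) * P (Y @^-1` B))%E) ->
  P [set t | obtuse_triangle (X t) (Y t) (0, 0)] =
  (1 - 1 / pi * asin (r1 / r2))%:E.
Proof.
move=> r1_gt0 r12 Xunif Yunif indep; have r2_gt0 := lt_le_trans r1_gt0 r12.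
have c01 : 0 < r1 / r2 <= 1 by rewrite divr_gt0//= ler_pdivrMr ?mul1r.
pose S : set (plane R * plane R) := [set q | obtuse_triangle q.1 q.2 (0, 0)].
have mS : measurable S by exact: measurable_obtuse_triangle.
rewrite (@probability_pair _ _ _ _ _ _ _ _ X Y S)//.
have mg : measurable_fun setT (fun x => distribution P Y (xsection S x)).
  exact: measurable_fun_xsection.
pose circle1 : {mfun measurableTypeR R >-> plane R} :=
  HB.pack (circle_point r1 : measurableTypeR R -> plane R)
    (isMeasurableFun.Build _ _ _ _ _ (@measurable_circle_point R r1)).
pose U : {measure set (measurableTypeR R) -> \bar R} :=
  uniform_prob (@two_pi_gt0 R).
rewrite (@eq_measure_integral _ _ _ _ (pushforward U circle1)); last first.
  by move=> A mA _; exact: Xunif.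
rewrite ge0_integral_pushforward//=; last exact: measurable_circle_point.
rewrite integral_uniform//=; last first.
  exact: (measurableT_comp mg (@measurable_circle_point R r1)).
rewrite (eq_integral (cst (1 - 1 / pi * asin (r1 / r2))%:E)); last first.
  (* For every angle [a] of the first vertex, the conditional probability is
     the same. *)
  move=> a; rewrite inE/= in_itv/= => a02.
  rewrite Yunif; last exact: measurable_xsection.
  rewrite -uniform_prob_obtuse_angles// -(@uniform_prob_rotation _ _ a)//;
    [|exact: measurable_obtuse_angles|exact: obtuse_anglesD2pi].
  congr uniform_prob; apply/seteqP; split => b /=; rewrite /xsection/= inE;
    by move/(obtuse_triangle_circle _ _ _ _ _ r1_gt0 r12).
rewrite integral_cst//= lebesgue_measure_itv/= lte_fin two_pi_gt0.
rewrite -EFinD -!EFinM; congr EFin; rewrite subr0 mulrCA mulVf ?mulr1//.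
by rewrite gt_eqF// two_pi_gt0.
Qed.

Lemma measurable_set1_plane (R : realType) (A : plane R) : measurable [set A].
Proof.
case: A => a b; rewrite (_ : [set _] = [set a] `*` [set b]).
  exact: measurableX.
by apply/seteqP; split => [_ -> //|[x y] [/= -> ->]].
Qed.

Lemma uniform_on_circle0 (d : measure_display) (T : measurableType d)
    (R : realType) (P : probability T R) (X : {RV P >-> plane R}) :
  uniform_on_circle 0 X -> P (X @^-1` [set (0, 0)]) = 1%E.
Proof.
move=> Xunif.
rewrite -[LHS]/(distribution P X _) Xunif; last exact: measurable_set1_plane.
rewrite /uniform_circle /pushforward.
rewrite (_ : _ @^-1` _ = setT) ?probability_setT//.
by apply/seteqP; split => x //= _; rewrite /circle_point !mul0r.
Qed.

Theorem corollary5p3 (R : realType) (d : measure_display)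
    (T : measurableType d) (P : probability T R) (r1 r2 r3 : R)
    (P1 P2 P3 : {RV P >-> plane R})
    (r3_eq0 : r3 = 0) (r1_gt0 : 0 < r1) (r1_le_r2 : r1 <= r2)
    (P1_unif : uniform_on_circle r1 P1)
    (P2_unif : uniform_on_circle r2 P2)
    (P3_unif : uniform_on_circle r3 P3)
    (indep : mutually_independent (tnth [tuple P1; P2; P3])) :
  P [set t | obtuse_triangle (P1 t) (P2 t) (P3 t)] =
    (1 - 1 / pi * asin (r1 / r2))%:E.
Proof.
rewrite -(probability_obtuse_circles _ _ _ _ _ _ P1 P2 r1_gt0 r1_le_r2)//;
  last by move=> A B; exact: mutually_independent_pair indep.
have P3_0 : P (P3 @^-1` [set (0, 0)]) = 1%E.
  by apply: uniform_on_circle0; rewrite -r3_eq0.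
have mP3_0 : measurable (P3 @^-1` [set (0, 0)]).
  by apply: measurable_funPTI; exact: measurable_set1_plane.
rewrite -[LHS](probability_setI1 _ _ _ _ _ _ _ mP3_0)//; last first.
  exact: measurable_obtuse_triangle.
rewrite -[RHS](probability_setI1 _ _ _ _ _ _ _ mP3_0)//; last first.
  exact: measurable_obtuse_triangle.
by congr (P _); apply/seteqP; split => t /= [h e]; move: h; rewrite e.
Qed.
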